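(* Let $\Omega\subset\mathbb{R}^n$ be a non-empty, bounded, open set and let $K\subset\mathbb{R}^m\times\mathbb{R}^m$ be compact. If $m>1$, assume in addition that $\widehat K^{\rm sc}$ is compact and that $$\widehat{\widehat K^{\rm sc}}=\bigcup_{(\alpha,\beta)\in \widehat K} Q_{\alpha,\beta}\qquad\text{with}\qquad \mathcal P_{\widehat K^{\rm sc}}\subset\{Q_{\alpha,\beta}: (\alpha,\beta)\in\widehat K\}.$$ Then $\mathcal A_K$ is $L^\infty$-weakly$^\ast$ closed if and only if $$\widehat{\widehat K^{\rm sc}}=\widehat K.$$ For $m=1$, the latter condition is equivalent to the separate convexity of $\widehat K$.
   Context: For $E\subset\mathbb{R}^m\times\mathbb{R}^m$, $\mathcal A_E:=\{u\in L^\infty(\Omega;\mathbb{R}^m): (u(x),u(y))\in E \text{ for a.e. }(x,y)\in\Omega\times\Omega\}$. $\mathcal A_K$ being $L^\infty$-weakly$^\ast$ closed means: if $(u_j)_j\subset\mathcal A_K$ and $u_j\rightharpoonup^\ast u$ in $L^\infty(\Omega;\mathbb{R}^m)$, then $u\in\mathcal A_K$ (for compact $K$ this sequential notion agrees with the topological one). $\widehat E:=\{(\xi,\zeta)\in E: (\xi,\xi),(\zeta,\xi),(\zeta,\zeta)\in E\}$. A set $E\subset\mathbb{R}^m\times\mathbb{R}^m$ is separately convex if for all $t\in(0,1)$ and all $(\xi_1,\zeta_1),(\xi_2,\zeta_2)\in E$ with $\xi_1=\xi_2$ or $\zeta_1=\zeta_2$ one has $t(\xi_1,\zeta_1)+(1-t)(\xi_2,\zeta_2)\in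 E$; $E^{\rm sc}$ is the smallest separately convex set containing $E$. $\widehat K^{\rm sc}$ means $(\widehat K)^{\rm sc}$, and $\widehat{\widehat K^{\rm sc}}$ is the symmetrization and diagonalization (the operation $\widehat{\ \cdot\ }$) of $(\widehat K)^{\rm sc}$. For $\alpha,\beta\in\mathbb{R}^m$, $[\alpha,\beta]:=\{t\alpha+(1-t)\beta: t\in[0,1]\}$ and $Q_{\alpha,\beta}:=[\alpha,\beta]\times[\alpha,\beta]$. $\mathcal P_E$ is the set of maximal Cartesian subsets of $E$: sets $P=A\times A\subset E$ with $A\subset\mathbb{R}^m$ such that $B=A$ for any $B\subset\mathbb{R}^m$ with $A\subset B$ and $B\times B\subset E$. *)

(* Defs.v *)
(* Stated with Mathematical Components and MathComp-Analysis. *)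
From HB Require Import structures.
From mathcomp Require Import all_boot all_order all_algebra.
From mathcomp Require Import all_classical all_reals all_analysis.
Import numFieldNormedType.Exports.
Import Order.TTheory GRing.Theory Num.Theory.

Set Implicit Arguments.
Unset Strict Implicit.
Unset Printing Implicit Defensive.

Local Open Scope classical_set_scope.
Local Open Scope ring_scope.

(* The sigma-algebra on row vectors generated by the coordinates, as the library
   does for tuples. On 'rV[R]_n it is the Borel sigma-algebra. *)
Definition measure_rV_display : measure_display -> measure_display.
Proof. exact. Qed.

Section measurable_rV.
Context {d} {T : measurableType d}.
Variable n : nat.

Let coors : 'I_n -> 'rV[T]_n -> T := fun i v => v ord0 i.

Let rV_set0 : g_sigma_preimage coors set0.
Proof. exact: sigma_algebra0. Qed.

Let rV_setC A : g_sigma_preimage coors A -> g_sigma_preimage coors (~` A).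
Proof. exact: sigma_algebraC. Qed.

Let rV_bigcup (F : _^nat) : (forall i, g_sigma_preimage coors (F i)) ->
  g_sigma_preimage coors (\bigcup_i (F i)).
Proof. exact: sigma_algebra_bigcup. Qed.

HB.instance Definition _ := @isMeasurable.Build (measure_rV_display d)
  'rV[T]_n (g_sigma_preimage coors) rV_set0 rV_setC rV_bigcup.

End measurable_rV.

Lemma measurable_rV_coord d (T : measurableType d) n (i : 'I_n) :
  measurable_fun [set: 'rV[T]_n] (fun v => v ord0 i).
Proof.
move=> _ Y mY; rewrite setTI; apply: sub_sigma_algebra => /=.
rewrite -bigcup_seq/=; exists i => /=; first by rewrite mem_index_enum.
by exists Y => //; rewrite setTI.
Qed.

Lemma measurable_fun_rVP d1 d2 (T1 : measurableType d1) (T2 : measurableType d2)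
    n (f : T1 -> 'rV[T2]_n) :
  measurable_fun [set: T1] f <->
  forall i, measurable_fun [set: T1] (fun x => f x ord0 i).
Proof.
split=> [mf i|mf].
  exact: (measurableT_comp (measurable_rV_coord i) mf).
apply: (@measurability _ _ _ _ _ _
  (\big[setU/set0]_(i < n)
     preimage_set_system setT (fun v : 'rV[T2]_n => v ord0 i) measurable)).
  by [].
move=> _ [B + <-]; rewrite -bigcup_seq/= => -[i _ [A mA <-]].
by rewrite setTI; apply: mf.
Qed.

Section lebesgue_rV.
Variable R : realType.

Definition rV_cons n (p : R * 'rV[R]_n) : 'rV[R]_n.+1 :=
  row_mx (p.1)%:M p.2 : 'rV[R]_(1 + n).

Definition rV_uncons n (v : 'rV[R]_n.+1) : R * 'rV[R]_n :=
  (v ord0 ord0, \row_i v ord0 (lift ord0 i)).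

Lemma rV_cons0 n (p : R * 'rV[R]_n) : rV_cons p ord0 ord0 = p.1.
Proof.
rewrite /rV_cons (_ : ord0 = lshift n (ord0 : 'I_1)); last exact/val_inj.
by rewrite [LHS]row_mxEl mxE.
Qed.

Lemma rV_consS n (p : R * 'rV[R]_n) i : rV_cons p ord0 (lift ord0 i) = p.2 ord0 i.
Proof.
rewrite /rV_cons (_ : lift ord0 i = rshift 1 i); last exact/val_inj.
by rewrite [LHS]row_mxEr.
Qed.

Lemma rV_consK n : cancel (@rV_cons n) (@rV_uncons n).
Proof.
move=> [x v]; rewrite /rV_uncons rV_cons0; congr pair.
by apply/rowP => i; rewrite mxE rV_consS.
Qed.

Lemma measurable_rV_cons n : measurable_fun [set: R * 'rV[R]_n] (@rV_cons n).
Proof.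
apply/measurable_fun_rVP => i; case: (unliftP ord0 i) => [j ->|->].
  under eq_fun do rewrite rV_consS.
  exact: (measurableT_comp (measurable_rV_coord j) measurable_snd).
under eq_fun do rewrite rV_cons0.
exact: measurable_fst.
Qed.

Lemma measurable_rV_uncons n :
  measurable_fun [set: 'rV[R]_n.+1] (@rV_uncons n).
Proof.
apply/measurable_fun_pairP; split; first exact: measurable_rV_coord.
apply/measurable_fun_rVP => i /=.
under eq_fun do rewrite mxE.
exact: measurable_rV_coord.
Qed.

Section step.
Variables (n : nat) (mu : {sigma_finite_measure set 'rV[R]_n -> \bar R}).

Definition lebesgue_rV_step : set 'rV[R]_n.+1 -> \bar R :=
  pushforward (lebesgue_measure \x mu)%E (@rV_cons n).

Let step0 : lebesgue_rV_step set0 = 0%E.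
Proof. by rewrite /lebesgue_rV_step /pushforward preimage_set0 measure0. Qed.

Let step_ge0 A : (0 <= lebesgue_rV_step A)%E.
Proof. by rewrite /lebesgue_rV_step /pushforward; exact: measure_ge0. Qed.

Let step_sigma_additive : semi_sigma_additive lebesgue_rV_step.
Proof.
exact: (@measure_semi_sigma_additive _ _ _
  (measure_function_pushforward__canonical__measure_function_Measure
    (lebesgue_measure \x mu)%E (@measurable_rV_cons n))).
Qed.

HB.instance Definition _ := isMeasure.Build _ _ _
  lebesgue_rV_step step0 step_ge0 step_sigma_additive.

Let step_sigma_finite : sigma_finite setT lebesgue_rV_step.
Proof.
have /sigma_finiteP[F [FT ndF Ffin]] := sigma_finiteT (@lebesgue_measure R).
have /sigma_finiteP[G [GT ndG Gfin]] := sigma_finiteT mu.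
exists (fun k => @rV_uncons n @^-1` (F k `*` G k)).
  apply/esym; rewrite -subTset => v _.
  have [k _ Fk] : (\bigcup_k F k) (rV_uncons v).1 by rewrite -FT.
  have [l _ Gl] : (\bigcup_k G k) (rV_uncons v).2 by rewrite -GT.
  exists (maxn k l) => //; split.
    by move: Fk; exact/subsetPset/ndF/leq_maxl.
  by move: Gl; exact/subsetPset/ndG/leq_maxr.
move=> k; have [mF Fk] := Ffin k; have [mG Gk] := Gfin k; split.
  by rewrite -[X in measurable X]setTI; apply: measurable_rV_uncons => //;
    exact: measurableX.
rewrite /lebesgue_rV_step /pushforward -comp_preimage.
rewrite (_ : _ \o _ = id); last by apply/funext => p; exact: rV_consK.
by rewrite preimage_id product_measure1E// lte_mul_pinfty// ge0_fin_numE.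
Qed.

HB.instance Definition _ := @Measure_isSigmaFinite.Build _ _ _
  lebesgue_rV_step step_sigma_finite.

End step.

(* The n-fold product of the one-dimensional Lebesgue measure. *)
Fixpoint lebesgue_rV n : {sigma_finite_measure set 'rV[R]_n -> \bar R} :=
  if n is n'.+1 then lebesgue_rV_step (lebesgue_rV n') else \d_(0 : 'rV[R]_0).

(* Normalization: a box has the product of the lengths of its sides as volume. *)
Lemma lebesgue_rV_box n (A : 'I_n -> set R) : (forall i, measurable (A i)) ->
  lebesgue_rV n [set v | forall i, A i (v ord0 i)] =
  (\prod_(i < n) lebesgue_measure (A i))%E.
Proof.
elim: n A => [|n IH] A mA.
  rewrite big_ord0 /= diracE mem_set//=; by case.
rewrite big_ord_recl -(IH (fun i => A (lift ord0 i)))//.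
pose B := [set v : 'rV[R]_n | forall i, A (lift ord0 i) (v ord0 i)].
have mB : measurable B.
  rewrite (_ : B = \bigcap_(i in [set: 'I_n])
      (fun v : 'rV[R]_n => v ord0 i) @^-1` A (lift ord0 i)).
    apply: fin_bigcap_measurable => // i _.
    by rewrite -[X in measurable X]setTI; exact: measurable_rV_coord.
  by apply/seteqP; split=> v /= h i; [move=> _|]; exact: h.
rewrite -[RHS](product_measure1E lebesgue_measure (lebesgue_rV n) (mA ord0) mB).
congr ((lebesgue_measure \x lebesgue_rV n)%E _).
apply/seteqP; split=> [p h|p [h0 h] i] /=.
  split=> [|i]; first by have := h ord0; rewrite rV_cons0.
  by have := h (lift ord0 i); rewrite rV_consS.
case: (unliftP ord0 i) => [j ->|->]; rewrite ?rV_consS ?rV_cons0//; exact: h.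
Qed.

End lebesgue_rV.

Section pair_sets.
Variables (R : realType) (m : nat).
Local Notation V := ('rV[R]_m).
Implicit Types (E P : set (V * V)) (A B : set V).

(* The set written with a wide hat over E. *)
Definition diag_sym E : set (V * V) :=
  [set p | [/\ E p, E (p.1, p.1), E (p.2, p.1) & E (p.2, p.2)]].

Definition separately_convex E : Prop :=
  forall (t : R) (p q : V * V), 0 < t < 1 -> E p -> E q ->
    p.1 = q.1 \/ p.2 = q.2 -> E (t *: p + (1 - t) *: q).

Definition sc_hull E : set (V * V) := smallest separately_convex E.

Definition segment (a b : V) : set V :=
  [set t *: a + (1 - t) *: b | t in [set t : R | 0 <= t <= 1]].

Definition square (a b : V) : set (V * V) := segment a b `*` segment a b.

Definition maximal_cartesian E : set (set (V * V)) :=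
  [set P | exists A, [/\ P = A `*` A, A `*` A `<=` E &
    forall B, A `<=` B -> B `*` B `<=` E -> B = A]].

End pair_sets.

Section inclusions.
Variables (R : realType) (n m : nat) (Omega : set 'rV[R]_n).
Local Notation mu := (lebesgue_rV R n).
Implicit Types u phi : 'rV[R]_n -> 'rV[R]_m.

(* Elements of the Lebesgue spaces on Omega are represented by functions on the
   whole of R^n whose values outside Omega are irrelevant. The norm on row
   vectors is the maximum norm, equivalent to the Euclidean one. *)
Definition Linfty u : Prop :=
  measurable_fun Omega u /\
  exists M : R, {ae mu, forall x, Omega x -> `|u x| <= M}.

Definition L1 phi : Prop :=
  forall i, mu.-integrable Omega (fun x => (phi x ord0 i)%:E).

Definition admissible (E : set ('rV[R]_m * 'rV[R]_m)) :
    set ('rV[R]_n -> 'rV[R]_m) :=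
  [set u | Linfty u /\
    {ae (mu \x mu)%E, forall p, Omega p.1 -> Omega p.2 -> E (u p.1, u p.2)}].

Definition dual_pairing u phi : R :=
  \int[mu]_(x in Omega) (\sum_(i < m) u x ord0 i * phi x ord0 i).

Definition weak_star_cvg (u_ : nat -> 'rV[R]_n -> 'rV[R]_m) u : Prop :=
  forall phi, L1 phi ->
    dual_pairing (u_ j) phi @[j --> \oo] --> dual_pairing u phi.

Definition weak_star_closed (A : set ('rV[R]_n -> 'rV[R]_m)) : Prop :=
  forall (u_ : nat -> 'rV[R]_n -> 'rV[R]_m) u,
    (forall j, A (u_ j)) -> Linfty u -> weak_star_cvg u_ u -> A u.

End inclusions.

(* Main.v *)
Require Import Defs.
From mathcomp Require Import all_boot all_order all_algebra.
From mathcomp Require Import all_classical all_reals all_analysis.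
From mathcomp Require Import measurable_realfun ring lra zify.
Import Order.TTheory GRing.Theory Num.Theory.
Import numFieldNormedType.Exports.
Import HBSimple.
Set Implicit Arguments.
Unset Strict Implicit.
Unset Printing Implicit Defensive.
Local Open Scope classical_set_scope.
Local Open Scope ring_scope.

(** Both sides of the equivalence say that every Cartesian square A x A in K is
    contained in some C x C with C closed and convex and C x C in K; call this
    property (P).

    The bridge between functions and Cartesian squares is the essential range of
    u, the support of the image of Lebesgue measure on Omega under u. If K is
    closed and u is admissible, then any two essential values form a pair in K
    (essential_range_pair); conversely a bounded function with values in A almost
    everywhere is admissible as soon as A x A lies in K
    (admissible_of_cartesian).

    (P) implies weak-star closedness (weak_star_closed_of_convex). If the u_j are
    admissible and converge weakly-star to u, the essential range of u_j lies in
    a compact convex C_j with C_j x C_j in K, so the averages of u_j over two sets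
    S and T form a pair in K (average_convex, proved by nearest point projection).
    These averages converge to those of u, hence the latter form a pair in K, and
    choosing for S and T sets where u is close to two essential values shows that
    these two values form a pair in K. No compactness of the family of the C_j is
    needed.

    Weak-star closedness implies (P) (weak_star_closed_convex). Zorn's lemma
    enlarges A to a set that is maximal with A x A in K. It is closed because K
    is, and it contains the midpoint of any two of its points a, b: a function
    that oscillates between a and b on one half of a small cube in Omega and
    equals d elsewhere converges weakly-star to a function with essential values
    (a + b) / 2 and d. The oscillation follows the Rademacher functions of one
    coordinate; these are orthogonal, so they tend weakly to 0 against bounded
    functions by Bessel's inequality, and against integrable functions by density
    (rademacher_cvg0). A closed set that contains its midpoints is convex.

    Write E for diag_sym K. If A x A lies in a separately convex set F, then so
    does D x D for some convex D containing A (separately_convex_cartesian), so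
    the condition diag_sym (sc_hull E) = E yields (P) after taking closures.
    Conversely (P) implies that E contains the square spanned by each of its
    points (square_filled_diag_sym). For m > 1 the structural assumption on
    diag_sym (sc_hull E) then concludes. For m = 1 a set that is symmetric and
    filled in this way is separately convex, because a point of a vertical or
    horizontal segment with endpoints in E lies in the square spanned by one of
    them (square_filled_separately_convex). *)


(** * Bessel's inequality and weak convergence to zero *)

Section bounded_measurable.
Context d (T : measurableType d) (R : realType).
Variables (mu : {measure set T -> \bar R}) (Q : set T).
Hypotheses (mQ : measurable Q) (Qfin : (mu Q < +oo)%E).

(** Measurable and bounded on Q. *)
Definition bounded_measurable (f : T -> R) : Prop :=
  measurable_fun Q f /\ exists M, forall x, Q x -> `|f x| <= M.

Lemma bounded_measurable_bounded f :
  bounded_measurable f -> [bounded f x | x in Q].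
Proof.
move=> [_ [M fM]]; exists M; split; first exact: num_real.
by move=> N MN x Qx /=; rewrite (le_trans (fM _ Qx))// ltW.
Qed.

Lemma bounded_measurable_integrable f :
  bounded_measurable f -> mu.-integrable Q (EFin \o f).
Proof.
move=> bf; apply: measurable_bounded_integrable => //; first exact: bf.1.
exact: bounded_measurable_bounded.
Qed.

Lemma integrable_boundedM g f : bounded_measurable g ->
  mu.-integrable Q (EFin \o f) ->
  mu.-integrable Q (EFin \o (fun x => g x * f x)).
Proof.
by move=> bg; apply: (integrableMr mQ bg.1 (bounded_measurable_bounded bg)).
Qed.

Lemma integrable_Rsum p (f : 'I_p -> T -> R) :
  (forall i, mu.-integrable Q (EFin \o f i)) ->
  mu.-integrable Q (EFin \o (fun x => \sum_(i < p) f i x)).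
Proof.
move=> intf; rewrite (_ : _ \o _ = fun x => (\sum_(i < p) (EFin \o f i) x)%E).
  by apply: integrable_sum => // i _; exact: intf.
by apply/funext => x /=; rewrite sumEFin.
Qed.

Lemma bounded_measurable_cst a : bounded_measurable (fun=> a).
Proof. by split; [exact: measurable_cst|exists `|a|]. Qed.

Lemma bounded_measurableD f g : bounded_measurable f -> bounded_measurable g ->
  bounded_measurable (fun x => f x + g x).
Proof.
move=> [mf [M fM]] [mg [N gN]]; split; first exact: measurable_funD.
by exists (M + N) => x Qx; rewrite (le_trans (ler_normD _ _))// lerD ?fM ?gN.
Qed.

Lemma bounded_measurableM f g : bounded_measurable f -> bounded_measurable g ->
  bounded_measurable (fun x => f x * g x).
Proof.
move=> [mf [M fM]] [mg [N gN]]; split; first exact: measurable_funM.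
by exists (M * N) => x Qx; rewrite normrM ler_pM ?fM ?gN.
Qed.

Lemma bounded_measurable_sum p (f : 'I_p -> T -> R) :
  (forall i, bounded_measurable (f i)) ->
  bounded_measurable (fun x => \sum_(i < p) f i x).
Proof.
elim: p f => [|p IH] f bf.
  by under eq_fun do rewrite big_ord0; exact: bounded_measurable_cst.
under eq_fun do rewrite big_ord_recr/=; apply: bounded_measurableD => //.
exact: (IH (fun i => f (widen_ord (leqnSn p) i))).
Qed.

Lemma eq_bounded_measurable f g : {in Q, f =1 g} ->
  bounded_measurable f -> bounded_measurable g.
Proof.
move=> fg [mf [M fM]]; split; first exact: eq_measurable_fun mf.
by exists M => x Qx; rewrite -fg ?inE// fM.
Qed.

Lemma Rintegral_sum p (f : 'I_p -> T -> R) :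
  (forall i, bounded_measurable (f i)) ->
  \int[mu]_(x in Q) (\sum_(i < p) f i x) = \sum_(i < p) \int[mu]_(x in Q) f i x.
Proof.
elim: p f => [|p IH] f bf.
  under eq_Rintegral do rewrite big_ord0.
  by rewrite big_ord0 Rintegral_cst// mul0r.
under eq_Rintegral do rewrite big_ord_recr/=.
rewrite RintegralD//; last 2 first.
- apply/bounded_measurable_integrable.
  exact: (@bounded_measurable_sum _ (fun i => f (widen_ord (leqnSn p) i))).
- exact/bounded_measurable_integrable.
by rewrite (IH (fun i => f (widen_ord (leqnSn p) i)))// big_ord_recr.
Qed.

End bounded_measurable.

(** Throughout this section the r k are orthogonal in L2 of Q, with the common
    squared norm c. *)
Section bessel.
Context d (T : measurableType d) (R : realType).
Variables (mu : {measure set T -> \bar R}) (Q : set T).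
Hypotheses (mQ : measurable Q) (Qfin : (mu Q < +oo)%E).
Variables (r : nat -> T -> R) (c : R).
Hypotheses (br : forall k, bounded_measurable Q (r k)) (c0 : 0 < c).
Hypothesis rr : forall j k, (j < k)%N -> \int[mu]_(x in Q) (r j x * r k x) = 0.
Hypothesis r2 : forall k, \int[mu]_(x in Q) (r k x * r k x) = c.

Local Notation bi := (bounded_measurable_integrable mQ Qfin).

(** The remainder of f after subtracting its projections on r 0, ..., r J.-1. *)
Fixpoint bessel_rem (f : T -> R) (J : nat) : T -> R :=
  if J is J'.+1 then fun x =>
    bessel_rem f J' x - (\int[mu]_(y in Q) (r J' y * f y)) / c * r J' x
  else f.

Lemma bounded_measurable_bessel_rem f J :
  bounded_measurable Q f -> bounded_measurable Q (bessel_rem f J).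
Proof.
move=> bf; elim: J => //= J IH; apply: bounded_measurableD => //.
under eq_fun do rewrite -mulNr.
apply: bounded_measurableM => //; exact: bounded_measurable_cst.
Qed.

Lemma Rintegral_bessel_rem f J k : bounded_measurable Q f -> (J <= k)%N ->
  \int[mu]_(x in Q) (r k x * bessel_rem f J x) = \int[mu]_(x in Q) (r k x * f x).
Proof.
move=> bf; elim: J => //= J IH Jk.
set a := _ / c.
transitivity (\int[mu]_(x in Q) (r k x * bessel_rem f J x - a * (r J x * r k x))).
  by apply: eq_Rintegral => x _; ring.
rewrite RintegralB//.
- by rewrite IH 1?ltnW// RintegralZl ?rr ?mulr0 ?subr0//; exact/bi/bounded_measurableM.
- by apply/bi/bounded_measurableM => //; exact: bounded_measurable_bessel_rem.
- apply/bi/bounded_measurableM; first exact: bounded_measurable_cst.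
  exact: bounded_measurableM.
Qed.

Lemma Rintegral_bessel_rem_sqr f J : bounded_measurable Q f ->
  \int[mu]_(x in Q) (bessel_rem f J x * bessel_rem f J x) =
  \int[mu]_(x in Q) (f x * f x) -
    \sum_(0 <= j < J) (\int[mu]_(x in Q) (r j x * f x)) ^+ 2 / c.
Proof.
move=> bf; elim: J => [|J IH]; first by rewrite big_geq// subr0.
rewrite big_nat_recr//= opprD addrA -IH.
set I := \int[mu]_(x in Q) (r J x * f x); set g := bessel_rem f J.
have bg : bounded_measurable Q g by exact: bounded_measurable_bessel_rem.
have bc a : bounded_measurable Q (fun=> a) by exact: bounded_measurable_cst.
transitivity (\int[mu]_(x in Q) ((g x * g x + (- 2 * (I / c)) * (r J x * g x)) +
    (I / c) ^+ 2 * (r J x * r J x))).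
  by apply: eq_Rintegral => x _; ring.
rewrite RintegralD//; last 2 first.
- apply/bi/bounded_measurableD; first exact: bounded_measurableM.
  apply: bounded_measurableM => //; exact: bounded_measurableM.
- apply/bi/bounded_measurableM => //; exact: bounded_measurableM.
rewrite RintegralD//; last 2 first.
- exact/bi/bounded_measurableM.
- apply/bi/bounded_measurableM => //; exact: bounded_measurableM.
rewrite !RintegralZl//; last 2 first.
- exact/bi/bounded_measurableM.
- exact/bi/bounded_measurableM.
rewrite r2 Rintegral_bessel_rem// -/I; field; exact: lt0r_neq0.
Qed.

(** Bessel's inequality makes the coefficients of a bounded function square
    summable. *)
Lemma bessel_cvg0 f : bounded_measurable Q f ->
  \int[mu]_(x in Q) (r k x * f x) @[k --> \oo] --> 0.
Proof.
move=> bf.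
pose u k := (\int[mu]_(x in Q) (r k x * f x)) ^+ 2 / c.
have u0 k : 0 <= u k by rewrite divr_ge0 ?sqr_ge0 ?ltW.
have : cvgn (series u).
  apply: nondecreasing_is_cvgn.
    by apply/nondecreasing_seqP => k; rewrite /series/= big_nat_recr//= lerDl.
  exists (\int[mu]_(x in Q) (f x * f x)) => _ [J _ <-].
  rewrite -subr_ge0 /series/= -Rintegral_bessel_rem_sqr//.
  by apply: Rintegral_ge0 => x _; rewrite -expr2 sqr_ge0.
move=> /cvg_series_cvg_0 u_0.
have {}u_0 : c * u k @[k --> \oo] --> 0.
  by rewrite -[X in _ --> X](mulr0 c); apply: cvgM => //; exact: cvg_cst.
apply/cvgrPdist_lt => e e0.
have e20 : 0 < e ^+ 2 by rewrite exprn_gt0.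
move/cvgrPdist_lt : u_0 => /(_ _ e20); apply: filterS => k.
rewrite !sub0r !normrN /u mulrCA divff ?lt0r_neq0// mulr1 normrX.
by rewrite ltr_pXn2r// nnegrE// ltW.
Qed.

(** If moreover the r k are uniformly bounded, their weak convergence to 0
    extends from bounded to integrable functions by density. *)
Lemma bessel_cvg0_integrable f : (forall k x, Q x -> `|r k x| <= 1) ->
  mu.-integrable Q (EFin \o f) ->
  \int[mu]_(x in Q) (r k x * f x) @[k --> \oo] --> 0.
Proof.
move=> r1 intf.
have [g [intg _ /fine_cvgP[_ gf]]] := approximation_sfun_integrable mQ intf.
apply/cvgrPdist_lt => e e0.
have e2 : 0 < e / 2 by rewrite divr_gt0.
move/cvgrPdist_lt : gf => /(_ _ e2)[N _ /(_ N (leqnn N))].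
rewrite sub0r normrN /=; set h := g N => fh.
have bh : bounded_measurable Q h.
  split; first exact: measurable_funTS.
  have [M [_ /= Mh]] := simple_bounded h.
  by exists (M + 1) => x _; apply: Mh => //; rewrite ltrDl.
move/cvgrPdist_lt : (bessel_cvg0 bh) => /(_ _ e2); apply: filterS => k.
rewrite !sub0r !normrN => kh.
have ifh : mu.-integrable Q (EFin \o (fun x => f x - h x)).
  rewrite (_ : _ \o _ = fun x => ((EFin \o f) x - (EFin \o h) x)%E)//.
  by apply: integrableB => //; exact: intg.
have -> : \int[mu]_(x in Q) (r k x * f x) =
    \int[mu]_(x in Q) (r k x * (f x - h x)) + \int[mu]_(x in Q) (r k x * h x).
  rewrite -RintegralD//; last 2 first.
  - exact: integrable_boundedM.
  - exact: (integrable_boundedM mQ (br k) (intg N)).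
  by apply: eq_Rintegral => x _; ring.
rewrite (le_lt_trans (ler_normD _ _))// (splitr e) ltrD//.
rewrite (le_lt_trans _ (le_lt_trans (ler_norm _) fh))//.
rewrite (le_trans (le_normr_Rintegral _ _))//; first exact: integrable_boundedM.
apply: le_Rintegral => //.
- exact/integrable_norm/integrable_boundedM.
- exact: integrable_norm.
- by move=> x Qx; rewrite normrM -[leRHS]mul1r ler_wpM2r// r1.
Qed.

End bessel.

(** * Rademacher functions of a uniformly distributed coordinate *)

(** The coordinate y is uniformly distributed on [0, 1[ under the restriction of
    mu to Q, whose total mass is c. *)
Section rademacher.
Context d (T : measurableType d) (R : realType).
Variables (mu : {measure set T -> \bar R}) (Q : set T) (y : T -> R) (c : R).
Hypotheses (mQ : measurable Q) (my : measurable_fun Q y) (c0 : 0 < c).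
Hypothesis y01 : forall x, Q x -> 0 <= y x < 1.
Hypothesis muy : forall a b, 0 <= a -> a <= b -> b <= 1 ->
  mu (Q `&` y @^-1` `[a, b[) = ((b - a) * c)%:E.

Lemma mu_unif : mu Q = c%:E.
Proof.
have -> : Q = Q `&` y @^-1` `[0, 1[.
  by apply/esym/setIidPl => x Qx; rewrite /= in_itv/= y01.
by rewrite muy// subr0 mul1r.
Qed.

Let Qfin : (mu Q < +oo)%E. Proof. by rewrite mu_unif ltry. Qed.

(** The index i of the dyadic interval [i / 2 ^ N, (i + 1) / 2 ^ N[ that
    contains y x. *)
Definition dyadic_digit N x : nat := Num.truncn (2 ^+ N * y x).

(** The part of Q where y lies in the i-th dyadic interval of length 2 ^ - N. *)
Definition dyadic_cell N i : set T :=
  Q `&` y @^-1` `[(i%:R / 2 ^+ N), (i.+1%:R / 2 ^+ N)[.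

Lemma dyadic_cellP N i x : Q x -> dyadic_cell N i x <-> dyadic_digit N x = i.
Proof.
move=> Qx; have /andP[y0 y1] := y01 Qx; have N0 : 0 < 2 ^+ N :> R by exact: exprn_gt0.
rewrite /dyadic_cell /= in_itv/= ler_pdivrMr// ltr_pdivlMr// [y x * _]mulrC.
rewrite -truncn_eq; last by rewrite mulr_ge0// ltW.
by split=> [[_ /eqP]|/eqP].
Qed.

Lemma dyadic_digit_lt N x : Q x -> (dyadic_digit N x < 2 ^ N)%N.
Proof.
move=> Qx; have /andP[y0 y1] := y01 Qx; have N0 : 0 < 2 ^+ N :> R by exact: exprn_gt0.
have : 0 <= 2 ^+ N * y x by rewrite mulr_ge0// ltW.
move=> /truncn_itv/andP[+ _]; rewrite -(ltr_nat R) => /le_lt_trans; apply.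
by rewrite natrX -[ltRHS]mulr1 ltr_pM2l.
Qed.

Lemma measurable_dyadic_cell N i : measurable (dyadic_cell N i).
Proof. exact: my. Qed.

Lemma mu_dyadic_cell N i : (i < 2 ^ N)%N -> mu (dyadic_cell N i) = (c / 2 ^+ N)%:E.
Proof.
move=> iN; have N0 : 0 < 2 ^+ N :> R by exact: exprn_gt0.
rewrite muy.
- by rewrite -mulrBl -natrB// subSnn mul1r mulrC.
- by rewrite divr_ge0 ?ler0n ?exprn_ge0.
- by rewrite ler_pM2r ?invr_gt0// ler_nat.
- by rewrite ler_pdivrMr// mul1r -natrX ler_nat.
Qed.

(** A function of the dyadic index is a combination of indicators of cells. *)
Lemma digit_indic (f : nat -> R) N x : Q x ->
  f (dyadic_digit N x) = \sum_(i < 2 ^ N) f i * \1_(dyadic_cell N i) x.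
Proof.
move=> Qx; rewrite (bigD1 (Ordinal (dyadic_digit_lt N Qx)))//= big1.
  by rewrite addr0 indicE mem_set ?mulr1//; exact/dyadic_cellP.
move=> i; rewrite -val_eqE/= => ni; rewrite indicE memNset ?mulr0//.
by move/(dyadic_cellP _ _ Qx) => di; rewrite di eqxx in ni.
Qed.

Lemma bounded_measurable_cell (a : R) N i :
  bounded_measurable Q (fun x => a * \1_(dyadic_cell N i) x).
Proof.
apply: bounded_measurableM; first exact: bounded_measurable_cst.
split; first exact/measurable_funTS/measurable_indic/measurable_dyadic_cell.
by exists 1 => x _; rewrite indicE; case: (_ \in _); rewrite ?normr1 ?normr0.
Qed.

Lemma bounded_measurable_digit (f : nat -> R) N :
  bounded_measurable Q (fun x => f (dyadic_digit N x)).
Proof.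
apply: (@eq_bounded_measurable _ _ _ _
  (fun x => \sum_(i < 2 ^ N) f i * \1_(dyadic_cell N i) x)).
  by move=> x /set_mem Qx; rewrite digit_indic.
apply: (@bounded_measurable_sum _ _ _ _ _ (fun i x => f i * \1_(dyadic_cell N i) x)).
move=> i; exact: bounded_measurable_cell.
Qed.

Lemma Rintegral_digit (f : nat -> R) N :
  \int[mu]_(x in Q) f (dyadic_digit N x) = (\sum_(i < 2 ^ N) f i) * (c / 2 ^+ N).
Proof.
transitivity (\int[mu]_(x in Q) \sum_(i < 2 ^ N) f i * \1_(dyadic_cell N i) x).
  by apply: eq_Rintegral => x /set_mem Qx; rewrite digit_indic.
rewrite (@Rintegral_sum _ _ _ mu Q mQ Qfin _ (fun i x => f i * \1_(dyadic_cell N i) x)).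
  rewrite mulr_suml; apply: eq_bigr => i _.
  rewrite RintegralZl//; last first.
    have := bounded_measurable_integrable mQ Qfin (bounded_measurable_cell 1 N i).
    by congr (_.-integrable _ _); apply/funext => x /=; rewrite mul1r.
  congr (_ * _); rewrite /Rintegral integral_indic//; last exact: measurable_dyadic_cell.
  by rewrite setIidl ?mu_dyadic_cell// => x [].
by move=> i; exact: bounded_measurable_cell.
Qed.

(** The Rademacher functions of the coordinate y; rademacher 0 is 1 where
    y < 1 / 2 and -1 where y >= 1 / 2. *)
Definition rademacher k x : R := (-1) ^+ dyadic_digit k.+1 x.

Lemma dyadic_digit_div N s x : Q x ->
  dyadic_digit N x = (dyadic_digit (N + s) x %/ 2 ^ s)%N.
Proof.
move=> Qx; have /andP[y0 y1] := y01 Qx; have N0 : 0 < 2 ^+ N :> R by exact: exprn_gt0.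
apply/eqP; rewrite /dyadic_digit truncn_eq; last by rewrite mulr_ge0// ltW.
have : 0 <= 2 ^+ (N + s) * y x by rewrite mulr_ge0// exprn_ge0.
move=> /truncn_itv; set D := Num.truncn _ => /andP[lo hi].
have s0 : 0 < 2 ^+ s :> R by exact: exprn_gt0.
have E : 2 ^+ (N + s) * y x = (2 ^+ N * y x) * 2 ^+ s by rewrite exprD; ring.
rewrite E in lo hi.
rewrite -(ler_pM2r s0) -(ltr_pM2r s0) -natrX -!natrM.
rewrite natrX (le_trans _ lo) ?ler_nat ?leq_divM//=.
by rewrite (lt_le_trans hi)// ler_nat ltn_ceil// expn_gt0.
Qed.

Lemma bounded_measurable_rademacher k : bounded_measurable Q (rademacher k).
Proof. exact: (bounded_measurable_digit (fun i => (-1) ^+ i)). Qed.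

Lemma rademacher_sqr k : \int[mu]_(x in Q) (rademacher k x * rademacher k x) = c.
Proof.
transitivity (\int[mu]_(x in Q) (1 : R)).
  by apply: eq_Rintegral => x _; rewrite /rademacher -expr2 sqrr_sign.
by rewrite Rintegral_cst// mul1r mu_unif.
Qed.

Lemma sum_alternating_double (f : nat -> R) p :
  (forall i, f i.*2.+1 = - f i.*2) -> \sum_(i < p.*2) f i = 0.
Proof.
move=> ff; elim: p => [|p IH]; first by rewrite big_ord0.
by rewrite doubleS !big_ord_recr/= IH add0r ff subrr.
Qed.

(** For j < k the function rademacher j is constant on the dyadic intervals of
    length 2 ^ - k, and rademacher k takes the values 1 and -1 on their halves. *)
Lemma rademacher_orthogonal j k : (j < k)%N ->
  \int[mu]_(x in Q) (rademacher j x * rademacher k x) = 0.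
Proof.
(* The product as a function of the dyadic index at level k + 1. *)
move=> jk; pose f i : R := (-1) ^+ (i %/ 2 ^ (k - j))%N * (-1) ^+ i.
transitivity (\int[mu]_(x in Q) f (dyadic_digit k.+1 x)).
  apply: eq_Rintegral => x /set_mem Qx; rewrite /rademacher /f.
  by rewrite (dyadic_digit_div j.+1 (k - j) Qx) addSn subnKC// ltnW.
rewrite Rintegral_digit expnS mul2n sum_alternating_double ?mul0r// => i.
rewrite /f exprS mulrCA mulN1r; congr (- (_ * _)).
have -> : (k - j = (k - j.+1).+1)%N by rewrite subnSK.
by rewrite expnS !divnMA; congr ((-1) ^+ (_ %/ _)); lia.
Qed.

Lemma rademacher_cvg0 f : mu.-integrable Q (EFin \o f) ->
  \int[mu]_(x in Q) (rademacher k x * f x) @[k --> \oo] --> 0.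
Proof.
apply: (bessel_cvg0_integrable mQ Qfin bounded_measurable_rademacher c0
  rademacher_orthogonal rademacher_sqr).
by move=> k x _; rewrite /rademacher normrX normrN1 expr1n.
Qed.

End rademacher.

(** * A countable base of measurable cubes *)

Section rational_boxes.
Context (R : realType) (m : nat).
Local Notation V := ('rV[R]_m).

(** The open cubes with rational centers and radii 1, 1/2, 1/3, ...: a countable
    base of the topology that consists of measurable sets. *)
Definition rat_box (c : 'rV[rat]_m * nat) : set V :=
  [set v | forall i, `|v ord0 i - ratr (c.1 ord0 i)| < c.2.+1%:R^-1].

Lemma measurable_coord_set (A : 'I_m -> set R) : (forall i, measurable (A i)) ->
  measurable [set v : V | forall i, A i (v ord0 i)].
Proof.
move=> mA; rewrite (_ : [set _ | _] =
    \bigcap_(i in [set: 'I_m]) (fun v : V => v ord0 i) @^-1` A i).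
  apply: fin_bigcap_measurable => // i _.
  by rewrite -[X in measurable X]setTI; exact: measurable_rV_coord.
by apply/seteqP; split=> v /= h i; [move=> _|]; exact: h.
Qed.

Lemma rat_boxE c : rat_box c =
  [set v | forall i, ball (ratr (c.1 ord0 i) : R) c.2.+1%:R^-1 (v ord0 i)].
Proof.
apply/seteqP; split=> v h i; have := h i; rewrite -ball_normE /ball_/= distrC//.
Qed.

Lemma measurable_rat_box c : measurable (rat_box c).
Proof.
rewrite rat_boxE; apply: (@measurable_coord_set (fun i => ball _ _)) => i.
exact: measurable_ball.
Qed.

Lemma rat_box_base (v : V) U : nbhs v U ->
  exists c, rat_box c v /\ rat_box c `<=` U.
Proof.
move=> /nbhs_ballP[e /= e0 eU].
have [k ke] : exists k, k.+1%:R^-1 < e / 2 :> R.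
  have [k _ /(_ k (leqnn k))] :=
    near_infty_natSinv_lt (PosNum (divr_gt0 e0 (ltr0Sn R 1))).
  by exists k.
have k0 : 0 < k.+1%:R^-1 :> R by rewrite invr_gt0.
have /choice[q vq] i : exists q : rat, `|v ord0 i - ratr q| < k.+1%:R^-1.
  have [|q] := @rat_in_itvoo R (v ord0 i - k.+1%:R^-1) (v ord0 i + k.+1%:R^-1).
    by rewrite ltrBlDr -addrA ltrDl addr_gt0.
  by rewrite in_itv/= -ltr_distl distrC; exists q.
exists (\row_i q i, k); split=> [i|w qw]; first by rewrite mxE.
apply: eU; split=> // i j; rewrite (ord1 i) -ball_normE /ball_/=.
have := qw j; have := vq j; rewrite /= mxE => vj wj.
rewrite -(subrKA (ratr (q j))) (le_lt_trans (ler_normD _ _))//.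
rewrite (splitr e) ltrD ?(lt_trans vj)// distrC (lt_trans wj)//.
Qed.

Lemma open_measurable_rV (U : set V) : open U -> measurable U.
Proof.
move=> oU; have -> : U = \bigcup_(c : 'rV[rat]_m * nat)
    (if `[< rat_box c `<=` U >] then rat_box c else set0).
  apply/seteqP; split=> [v Uv|v [c _]]; last by case: asboolP => // cU; exact: cU.
  have [c [cv cU]] := rat_box_base (open_nbhs_nbhs (conj oU Uv)).
  by exists c => //; rewrite asboolT.
apply: countable_bigcupT_measurable; first exact: countableP.
by move=> c; case: asboolP => // _; exact: measurable_rat_box.
Qed.

End rational_boxes.

(** * Lebesgue measure of boxes *)

Section lebesgue_boxes.
Context (R : realType).

Lemma ler_coord_norm n (v : 'rV[R]_n) i : `|v ord0 i| <= `|v|.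
Proof.
rewrite [leRHS]/Num.norm /= mx_normrE.
by apply/bigmax_geP; right => /=; exists (ord0, i).
Qed.

Lemma bounded_set_rV_finite n (A : set 'rV[R]_n) : measurable A ->
  bounded_set A -> (lebesgue_rV R n A < +oo)%E.
Proof.
move=> mA [M [_ AM]].
pose B := [set v : 'rV[R]_n | forall i, ball (0 : R) (`|M| + 2) (v ord0 i)].
have AB : A `<=` B.
  move=> v Av i; rewrite -ball_normE /ball_/= sub0r normrN.
  have /AM/(_ _ Av) : M < `|M| + 1 by rewrite (le_lt_trans (ler_norm _))// ltrDl.
  move=> /= vM; rewrite (le_lt_trans (ler_coord_norm _ _))//.
  by rewrite (le_lt_trans vM)// ltrD2l ltr1n.
have mB : measurable B.
  apply: (@measurable_coord_set R n (fun=> ball _ _)) => i; exact: measurable_ball.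
apply: (le_lt_trans (le_measure _ _ _ AB)); rewrite ?inE//.
change (lebesgue_rV R n B < +oo)%E.
have -> : lebesgue_rV R n B =
    (\prod_(i < n) lebesgue_measure (ball (0 : R)%R (`|M| + 2)%R))%E.
  apply: (@lebesgue_rV_box R n (fun=> ball 0 (`|M| + 2))) => i.
  exact: measurable_ball.
under eq_bigr do rewrite lebesgue_measure_ball ?addr_ge0//.
by rewrite prodEFin ltry.
Qed.

(** The box whose first side is [q_0 + a l, q_0 + b l[ and whose other sides are
    the open intervals of center q_i and radius l. *)
Definition slab n (q : 'rV[R]_n.+1) (l a b : R) : set 'rV[R]_n.+1 :=
  [set v | forall i : 'I_n.+1, (if i == ord0
    then `[q ord0 ord0 + a * l, q ord0 ord0 + b * l[%classic
    else ball (q ord0 i) l) (v ord0 i)].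

Lemma measurable_slab n (q : 'rV[R]_n.+1) l a b : measurable (slab q l a b).
Proof.
apply: (@measurable_coord_set R n.+1 (fun i => if i == ord0 then _ else _)) => i.
by case: ifP => // _; exact: measurable_ball.
Qed.

Lemma lebesgue_slab n (q : 'rV[R]_n.+1) l a b : 0 < l -> a <= b ->
  lebesgue_rV R n.+1 (slab q l a b) = ((b - a) * (l * (l *+ 2) ^+ n))%:E.
Proof.
move=> l0 ab; pose A (i : 'I_n.+1) : set R := if i == ord0
  then `[q ord0 ord0 + a * l, q ord0 ord0 + b * l[%classic else ball (q ord0 i) l.
have -> : lebesgue_rV R n.+1 (slab q l a b) = (\prod_i lebesgue_measure (A i))%E.
  apply: lebesgue_rV_box => i.
  by rewrite /A; case: ifP => // _; exact: measurable_ball.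
rewrite /A big_ord_recl eqxx.
under eq_bigr do rewrite /= lebesgue_measure_ball ?ltW//.
rewrite prodEFin prodr_const card_ord lebesgue_measure_itv/= lte_fin ltrD2l ltr_pM2r//.
rewrite mulrA EFinM; congr (_ * _)%E.
move: ab; rewrite le_eqVlt => /predU1P[->|ab]; first by rewrite ltxx subrr mul0r.
by rewrite ab -EFinB; congr EFin; ring.
Qed.

Lemma slab_sub_box n (c : 'rV[rat]_n.+1 * nat) a b : -1 < a -> b <= 1 ->
  slab (\row_i ratr (c.1 ord0 i)) c.2.+1%:R^-1 a b `<=` rat_box c.
Proof.
move=> a1 b1 v h; rewrite rat_boxE => i; have := h i; rewrite !mxE.
case: eqP => // -> /=; rewrite in_itv/= => /andP[lo hi].
have l0 : 0 < c.2.+1%:R^-1 :> R by rewrite invr_gt0.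
rewrite -ball_normE /ball_/= distrC ltr_distl; apply/andP; split.
  by apply: lt_le_trans lo; rewrite ltrD2l -mulN1r ltr_pM2r.
by apply: (lt_le_trans hi); rewrite lerD2l -[leRHS]mul1r ler_pM2r.
Qed.

End lebesgue_boxes.

(** * Essential ranges and admissible functions *)

Section essential_range.
Context (R : realType) (n m : nat) (Omega : set 'rV[R]_n).
Hypothesis mO : measurable Omega.
Local Notation mu := (lebesgue_rV R n).
Implicit Types (u : 'rV[R]_n -> 'rV[R]_m) (K : set ('rV[R]_m * 'rV[R]_m)).

(** The part of Omega where u takes values in the cube c. *)
Definition piece u c : set 'rV[R]_n := Omega `&` u @^-1` rat_box c.

(** The essential range of u on Omega, i.e. the support of the image measure. *)
Definition essential_range u : set 'rV[R]_m :=
  [set xi | forall c, rat_box c xi -> (0 < mu (piece u c))%E].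

Lemma measurable_piece u c : measurable_fun Omega u -> measurable (piece u c).
Proof. by move=> mu_; apply: mu_ => //; exact: measurable_rat_box. Qed.

Lemma ae_essential_range u : measurable_fun Omega u ->
  {ae mu, forall x, Omega x -> essential_range u (u x)}.
Proof.
move=> mu_.
(* The union of the countably many null pieces, enumerated by pickle. *)
pose N k := if unpickle k is Some c then
  if mu (piece u c) == 0%E then piece u c else set0 else set0.
have : mu.-negligible (\bigcup_k N k).
  apply: negligible_bigcup => k; rewrite /N.
  case: unpickle => [c|]; last exact: negligible_set0.
  case: eqP => [c0|_]; last exact: negligible_set0.
  by exists (piece u c); split=> //; exact: measurable_piece.
apply: negligibleS => x /= /not_implyP[Ox /existsNP[c /not_implyP[cx /negP]]].
rewrite lt0e measure_ge0 andbT negbK => c0.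
by exists (pickle c) => //; rewrite /N pickleK c0.
Qed.

(** A property of almost all pairs holds somewhere on S x T when S and T have
    positive measure. *)
Lemma ae_product_point (P : set ('rV[R]_n * 'rV[R]_n)) (S T : set 'rV[R]_n) :
  {ae (mu \x mu)%E, forall p, P p} -> measurable S -> measurable T ->
  (0 < mu S)%E -> (0 < mu T)%E -> exists x y, [/\ S x, T y & P (x, y)].
Proof.
move=> [Z [mZ Z0 PZ]] mS mT S0 T0; apply: contrapT => h.
have : (mu \x mu)%E (S `*` T) = 0%E.
  apply: (subset_measure0 (measurableX mS mT) mZ _ Z0) => -[x y] [/= Sx Ty].
  by apply: PZ => /= Pxy; apply: h; exists x, y.
rewrite product_measure1E// => /eqP.
by rewrite mule_eq0 !gt_eqF.
Qed.

(** A pair of essential values belongs to every closed set that contains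
    almost all pairs of values. *)
Lemma essential_range_pair u K xi zeta : closed K -> admissible Omega K u ->
  essential_range u xi -> essential_range u zeta -> K (xi, zeta).
Proof.
move=> cK [[mu_ _] uK] exi ezeta; apply: cK => B [[U W]/= [xiU zetaW] UWB].
have [c [cxi cU]] := rat_box_base xiU.
have [c' [czeta cW]] := rat_box_base zetaW.
have [|||||x [y [[Ox cx] [Oy cy] Kxy]]] := @ae_product_point
  (fun p => Omega p.1 -> Omega p.2 -> K (u p.1, u p.2)) (piece u c) (piece u c').
- exact: uK.
- exact: measurable_piece.
- exact: measurable_piece.
- exact: exi.
- exact: ezeta.
by exists (u x, u y); split; [exact: Kxy|apply: UWB; split; [exact: cU|exact: cW]].
Qed.

Lemma admissible_of_cartesian u K A : A `*` A `<=` K -> Linfty Omega u ->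
  {ae mu, forall x, Omega x -> A (u x)} -> admissible Omega K u.
Proof.
move=> AK uoo [N [mN N0 AN]]; split=> //.
have N1 : (mu \x mu)%E.-negligible (N `*` setT).
  exists (N `*` setT); split => //; first exact: measurableX.
  by rewrite product_measure1E// [X in (X * _)%E]N0 mul0e.
have N2 : (mu \x mu)%E.-negligible (setT `*` N).
  exists (setT `*` N); split => //; first exact: measurableX.
  by rewrite product_measure1E// [X in (_ * X)%E]N0 mule0.
apply: negligibleS (negligibleU N1 N2).
move=> [x y] /= /not_implyP[Ox /not_implyP[Oy nK]].
have [Ax|nAx] := pselect (A (u x)); last by left; split=> //; apply: AN => /(_ Ox).
right; split=> //; apply: AN => /(_ Oy) Ay; apply: nK; exact: AK.
Qed.

End essential_range.

(** * Convex sets, Cartesian squares and averages *)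

Section convexity.
Context (R : realType) (m : nat).
Local Notation V := ('rV[R]_m).
Implicit Types (A C D : set V) (E F K : set (V * V)).

(** Convexity in terms of explicit combinations. *)
Lemma convex_setE A : convex_set A <->
  forall t a b, 0 < t < 1 -> A a -> A b -> A (t *: a + (1 - t) *: b).
Proof.
rewrite convex_setW; split=> [h t a b /andP[t0 t1] Aa Ab|h a b].
  have := h a b (mem_set Aa) (mem_set Ab) (Itv01 (ltW t0) (ltW t1)) t0 t1.
  exact: set_mem.
move=> /set_mem Aa /set_mem Ab t t0 t1.
by apply/mem_set/h => //; apply/andP; split.
Qed.

Lemma combination_cvg (t : R) (a b : V) :
  t *: p.1 + (1 - t) *: p.2 @[p --> nbhs (a, b)] --> t *: a + (1 - t) *: b.
Proof.
apply: cvgD; (apply: cvgZ; first exact: cvg_cst); [exact: cvg_fst|exact: cvg_snd].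
Qed.

Lemma convex_closure A : convex_set A -> convex_set (closure A).
Proof.
rewrite !convex_setE => cA t a b t01 Aa Ab W.
move=> /(@combination_cvg t a b)[[U U']/= [aU bU'] UW].
have [x [Ax Ux]] := Aa _ aU; have [y [Ay Uy]] := Ab _ bU'.
by exists (t *: x + (1 - t) *: y); split; [exact: cA|exact: (UW (x, y))].
Qed.

Lemma cartesian_closure A K : closed K -> A `*` A `<=` K ->
  closure A `*` closure A `<=` K.
Proof.
move=> cK AK [a b] [/= Aa Ab]; apply: cK => W [[U U']/= [aU bU'] UW].
have [x [Ax Ux]] := Aa _ aU; have [y [Ay Uy]] := Ab _ bU'.
by exists (x, y); split; [exact: AK|exact: UW].
Qed.

(** Midpoints generate all dyadic combinations, which are dense. *)
Lemma closed_midpoint_convex A : closed A ->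
  (forall a b, A a -> A b -> A (2^-1 *: (a + b))) -> convex_set A.
Proof.
move=> cA mid; apply/convex_setE => t a b /andP[t0 t1] Aa Ab.
pose g (s : R) : V := s *: a + (1 - s) *: b.
have dyadic N i : (i <= 2 ^ N)%N -> A (g (i%:R / 2 ^+ N)).
  elim: N i => [|N IH] i iN.
    move: iN; rewrite expn0 /g expr0 divr1; case: i => [|[|//]] _.
      by rewrite scale0r add0r subr0 scale1r.
    by rewrite scale1r subrr scale0r addr0.
  have N0 : 2 ^+ N != 0 :> R by rewrite expf_neq0.
  (* A dyadic at level N + 1 is the midpoint of two dyadics at level N. *)
  have -> : g (i%:R / 2 ^+ N.+1) =
      2^-1 *: (g (i./2%:R / 2 ^+ N) + g ((uphalf i)%:R / 2 ^+ N)).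
    have -> : i%:R = i./2%:R + (uphalf i)%:R :> R.
      by rewrite -natrD; congr (_%:R); lia.
    by apply/rowP => k; rewrite !mxE exprS; field.
  by apply: mid; apply: IH; move: iN; rewrite expnS; lia.
apply: cA => W tW.
have gW : g s @[s --> t] --> g t.
  apply: cvgD; (apply: cvgZ; last exact: cvg_cst); first exact: cvg_id.
  by apply: cvgB; [exact: cvg_cst|exact: cvg_id].
have /nbhs_ballP[e /= e0 eW] := gW _ tW.
have [N Ne] : exists N, (2 ^+ N)^-1 < e :> R.
  have [k _ /(_ k (leqnn k)) ke] := near_infty_natSinv_lt (PosNum e0).
  exists k; apply: le_lt_trans ke; rewrite lef_pV2 ?posrE ?exprn_gt0//.
  by rewrite -natrX ler_nat ltn_expl.
have N0 : 0 < 2 ^+ N :> R by exact: exprn_gt0.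
have /truncn_itv : 0 <= 2 ^+ N * t by rewrite mulr_ge0// ltW.
set i := Num.truncn _ => /andP[lo hi].
exists (g (i%:R / 2 ^+ N)); split.
  apply: dyadic; rewrite -(ler_nat R) (le_trans lo)// natrX.
  by rewrite -[leRHS]mulr1 ler_pM2l// ltW.
apply: eW; rewrite -ball_normE /ball_/= ger0_norm; last first.
  by rewrite subr_ge0 ler_pdivrMr// mulrC.
apply: lt_trans Ne; rewrite ltrBlDr -(ltr_pM2l N0) mulrDr divff ?lt0r_neq0//.
by rewrite mulrCA divff ?lt0r_neq0// mulr1 addrC natr1.
Qed.

(** A Cartesian square inside a separately convex set can be enlarged to the
    square of a convex set: intersect the polar of A with its bipolar, for the
    relation F. *)
Lemma separately_convex_cartesian F A : separately_convex F -> A `*` A `<=` F ->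
  exists D, [/\ convex_set D, A `<=` D & D `*` D `<=` F].
Proof.
move=> sF AF; pose B := [set b | forall a, A a -> F (a, b)].
pose C := [set c | forall b, B b -> F (c, b)].
have fixed (t : R) (a : V) : t *: a + (1 - t) *: a = a.
  by rewrite -scalerDl addrC subrK scale1r.
exists (B `&` C); split.
- apply/convex_setE => t a b t01 [Ba Ca] [Bb Cb]; split=> c hc.
    have := sF t (c, a) (c, b) t01 (Ba _ hc) (Bb _ hc) (or_introl erefl).
    by congr F; congr pair; rewrite /= fixed.
  have := sF t (a, c) (b, c) t01 (Ca _ hc) (Cb _ hc) (or_intror erefl).
  by congr F; congr pair; rewrite /= fixed.
- move=> a Aa; split=> [b Ab|b Bb]; first exact: AF.
  exact: Bb.
- by move=> [b c] [/= [_ Cb] [Bc _]]; exact: Cb.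
Qed.

(** By Zorn's lemma every Cartesian square in K extends to a maximal one;
    maximality is expressed by the points that can be added. *)
Lemma maximal_cartesian_ext K A0 : A0 `*` A0 `<=` K ->
  exists A, [/\ A0 `<=` A, A `*` A `<=` K & forall z, K (z, z) ->
    (forall a, A a -> K (z, a) /\ K (a, z)) -> A z].
Proof.
move=> A0K; pose P := [set X | (A0 `|` X) `*` (A0 `|` X) `<=` K].
have [|X [PX maxX]] := @Zorn_bigcup _ P.
  move=> F FP tF [x y] [/= [A0x|[X FX Xx]] [A0y|[Y FY Yy]]].
  - exact: A0K.
  - by apply: (FP _ FY); split; [left|right].
  - by apply: (FP _ FX); split; [right|left].
  - have [XY|YX] := tF _ _ FX FY.
      by apply: (FP _ FY); split; right => //=; exact: XY.
    by apply: (FP _ FX); split; right => //=; exact: YX.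
exists (A0 `|` X); split; [by move=> x; left|exact: PX|].
move=> z zz zA; apply: contrapT => nz.
apply: (maxX (X `|` [set z])).
  by split=> [x|/(_ z (or_intror erefl)) Xz]; [left|apply: nz; right].
move=> [x y]; rewrite setUA => -[/= [Ax|->] [Ay|->]] //.
- exact: PX.
- exact: (zA _ Ax).2.
- exact: (zA _ Ay).1.
Qed.

End convexity.

Section averages.
Context d (T : measurableType d) (R : realType) (m : nat).
Variable mu : {measure set T -> \bar R}.
Local Notation V := ('rV[R]_m).
Implicit Types (u : T -> V) (S : set T) (C : set V).

(** The mean value of u over S, coordinate by coordinate. *)
Definition average S u : V :=
  \row_i ((fine (mu S))^-1 * \int[mu]_(x in S) u x ord0 i).

(** The nearest point of C to any v is characterized by a variational
    inequality. *)
Lemma convex_projection C (v : V) : convex_set C -> compact C -> C !=set0 ->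
  exists2 p, C p & forall a, C a ->
    \sum_i (v ord0 i - p ord0 i) * (a ord0 i - p ord0 i) <= 0.
Proof.
move=> /convex_setE cC kC C0.
pose f (p : V) := \sum_i (v ord0 i - p ord0 i) ^+ 2.
have cf : continuous f.
  rewrite /f; elim: (index_enum _) => [|i r IH].
    by under eq_fun do rewrite big_nil; exact: cst_continuous.
  under eq_fun do rewrite big_cons expr2.
  move=> p; have np : Filter (nbhs p) by exact: nbhs_filter.
  have cg : v ord0 i - q ord0 i @[q --> p] --> v ord0 i - p ord0 i.
    by apply: (@cvgB R R V (nbhs p) np); [exact: cvg_cst|exact: coord_continuous].
  by apply: (@cvgD R R V (nbhs p) np); [exact: cvgM|exact: IH].
have [p /set_mem Cp minp] := EVT_min_rV C0 kC (continuous_subspaceT cf).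
exists p => // a Ca; set s := \sum_i _.
pose q := \sum_i (a ord0 i - p ord0 i) ^+ 2.
have q0 : 0 <= q by apply: sumr_ge0 => i _; exact: sqr_ge0.
have le_s t : 0 < t < 1 -> 2 * s <= t * q.
  move=> t01; have /andP[t0 t1] := t01.
  have := minp _ (mem_set (cC _ _ _ t01 Ca Cp)).
  have -> : f (t *: a + (1 - t) *: p) = f p - 2 * t * s + t ^+ 2 * q.
    rewrite /f /s /q !mulr_sumr -sumrB -big_split/=.
    by apply: eq_bigr => i _; rewrite !mxE; ring.
  rewrite -addrA lerDl addrC subr_ge0 [2 * t]mulrC expr2 -!mulrA.
  by rewrite ler_pM2l.
(* If s > 0, a small t in ]0, 1[ violates le_s; this t satisfies t q < s. *)
rewrite leNgt; apply/negP => s0.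
have q1 : 0 < q + 1 + s + s by lra.
have := le_s (s / (q + 1 + s + s)).
rewrite divr_gt0//= ltr_pdivrMr// mul1r.
have -> : s < q + 1 + s + s by lra.
move=> /(_ isT); apply/negP; rewrite -ltNge mulrAC ltr_pdivrMr//.
by rewrite -subr_gt0; nra.
Qed.

(** The average of a function with values in a compact convex set belongs to
    that set. *)
Lemma average_convex S u C : measurable S -> (0 < mu S)%E -> (mu S < +oo)%E ->
  (forall i, measurable_fun S (fun x => u x ord0 i)) ->
  convex_set C -> compact C -> {ae mu, forall x, S x -> C (u x)} ->
  C (average S u).
Proof.
move=> mS S0 Soo muS cC kC [N [mN N0 uC]].
have NC x : (S `\` N) x -> C (u x).
  by move=> [Sx nNx]; apply: contrapT => nC; apply/nNx/uC => /(_ Sx).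
have mSN : measurable (S `\` N) by exact: measurableD.
have muSN : mu (S `\` N) = mu S.
  have SN0 : mu (S `&` N) = 0%E.
    by apply: (subset_measure0 (measurableI _ _ mS mN) mN) => // x [].
  transitivity (mu (S `\` N) + mu (S `&` N))%E; first by rewrite SN0 adde0.
  exact/esym/measureDI.
have SNoo : (mu (S `\` N) < +oo)%E by rewrite muSN.
have bu i : bounded_measurable (S `\` N) (fun x => u x ord0 i).
  split; first exact: measurable_funS (muS i).
  have [M [_ CM]] := compact_bounded kC.
  exists (M + 1) => x /NC Cx; rewrite (le_trans (ler_coord_norm _ _))//.
  by apply: CM => //; rewrite ltrDl.
have intE i : \int[mu]_(x in S) u x ord0 i = \int[mu]_(x in S `\` N) u x ord0 i.
  congr fine; apply: negligible_integral => //.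
  apply/(negligible_integrable mN mS _ N0).
    exact/measurable_EFinP.
  exact: (bounded_measurable_integrable mSN SNoo (bu i)).
have [x0 SNx0] : (S `\` N) !=set0.
  apply/set0P/eqP => SN0; move: S0; rewrite -muSN SN0 measure0.
  by rewrite ltxx.
set c := average S u; set s := fine (mu S).
have s0 : 0 < s by rewrite fine_gt0// S0 Soo.
have [p Cp pmin] := convex_projection c cC kC (ex_intro _ _ (NC _ SNx0)).
suff -> : c = p by [].
(* Integrating the variational inequality at p gives |c - p| ^ 2 <= 0. *)
have : 0 <= \int[mu]_(x in S `\` N)
    \sum_i (c ord0 i - p ord0 i) * (p ord0 i - u x ord0 i).
  apply: Rintegral_ge0 => x /NC /pmin; rewrite -oppr_ge0 -sumrN.
  by congr (0 <= _); apply: eq_bigr => i _; ring.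
have bp i : bounded_measurable (S `\` N) (fun x => p ord0 i - u x ord0 i).
  apply: bounded_measurableD; first exact: bounded_measurable_cst.
  under eq_fun do rewrite -mulN1r.
  by apply: bounded_measurableM => //; exact: bounded_measurable_cst.
rewrite (Rintegral_sum mSN SNoo
  (f := fun i x => (c ord0 i - p ord0 i) * (p ord0 i - u x ord0 i))); last first.
  by move=> i; apply: bounded_measurableM => //; exact: bounded_measurable_cst.
have -> : \sum_(i < m) \int[mu]_(x in S `\` N)
    ((c ord0 i - p ord0 i) * (p ord0 i - u x ord0 i)) =
    - (s * \sum_(i < m) (c ord0 i - p ord0 i) ^+ 2).
  rewrite mulr_sumr -sumrN; apply: eq_bigr => i _.
  rewrite RintegralZl//; last exact: (bounded_measurable_integrable mSN SNoo (bp i)).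
  rewrite RintegralB//; last 2 first.
  - exact/(bounded_measurable_integrable mSN SNoo)/bounded_measurable_cst.
  - exact: (bounded_measurable_integrable mSN SNoo (bu i)).
  rewrite Rintegral_cst// muSN -intE -/s.
  have -> : \int[mu]_(x in S) u x ord0 i = s * c ord0 i.
    by rewrite /c /average mxE -/s mulrA divff ?lt0r_neq0// mul1r.
  by ring.
rewrite oppr_ge0 pmulr_rle0// => le0.
have /eqP : \sum_(i < m) (c ord0 i - p ord0 i) ^+ 2 = 0.
  by apply/eqP; rewrite eq_le le0/= sumr_ge0// => i _; exact: sqr_ge0.
rewrite psumr_eq0 => [/allP cp|i _]; last exact: sqr_ge0.
apply/rowP => i; apply/eqP; rewrite -subr_eq0 -sqrf_eq0.
by apply: cp; rewrite mem_index_enum.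
Qed.

End averages.

(** * Weak-star limits when Cartesian squares have convex enlargements *)

Section weak_star.
Context (R : realType) (n m : nat) (Omega : set 'rV[R]_n).
Local Notation mu := (lebesgue_rV R n).
Local Notation V := ('rV[R]_m).
Hypotheses (mO : measurable Omega) (Ofin : (mu Omega < +oo)%E).
Implicit Types (u : 'rV[R]_n -> V) (K : set (V * V)) (S : set 'rV[R]_n).

(** The test function equal to the i-th basis vector on S and to 0 elsewhere. *)
Definition indic_test S (i : 'I_m) (x : 'rV[R]_n) : V :=
  \row_k ((k == i)%:R * \1_S x).

Lemma L1_indic_test S i : measurable S -> L1 Omega (indic_test S i).
Proof.
move=> mS k; apply: (bounded_measurable_integrable mO Ofin).
under eq_fun do rewrite mxE.
apply: bounded_measurableM; first exact: bounded_measurable_cst.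
split; first exact/measurable_funTS/measurable_indic.
by exists 1 => x _; rewrite indicE; case: (_ \in _); rewrite ?normr1 ?normr0.
Qed.

Lemma dual_pairing_indic_test u S i : S `<=` Omega ->
  dual_pairing Omega u (indic_test S i) = \int[mu]_(x in S) u x ord0 i.
Proof.
move=> SO; rewrite -[in RHS](setIidr SO) Rintegral_mkcondr; apply: eq_Rintegral => x _.
rewrite (bigD1 i)//= big1 ?addr0 => [|k ki]; last by rewrite mxE (negPf ki) mul0r mulr0.
by rewrite mxE eqxx mul1r indicE patchE; case: ifP; rewrite ?mulr1 ?mulr0.
Qed.

(** Convergence of row vectors is convergence of the coordinates. *)
Lemma rV_cvg (f : nat -> V) (v : V) :
  (forall i, f j ord0 i @[j --> \oo] --> v ord0 i) -> f j @[j --> \oo] --> v.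
Proof.
move=> fv; apply/cvg_ballP => e e0.
have : \forall j \near \oo, forall i : 'I_m, ball (v ord0 i) e (f j ord0 i).
  by apply: filter_forall => i; move/cvg_ballP : (fv i); exact.
by apply: filterS => j h; split=> // k i; rewrite (ord1 k); exact: h.
Qed.

(** Averages are continuous for weak-star convergence. *)
Lemma weak_star_cvg_average (u_ : nat -> 'rV[R]_n -> V) u S :
  measurable S -> S `<=` Omega -> weak_star_cvg Omega u_ u ->
  average mu S (u_ j) @[j --> \oo] --> average mu S u.
Proof.
move=> mS SO uu; apply: rV_cvg => i; rewrite mxE.
under eq_fun do rewrite mxE.
apply: cvgM; first exact: cvg_cst.
have := uu _ (L1_indic_test i mS).
rewrite dual_pairing_indic_test//.
by under eq_fun do rewrite dual_pairing_indic_test//.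
Qed.

(** If every Cartesian square in K lies in the square of a closed convex set
    contained in K, admissibility passes to weak-star limits. *)
Lemma weak_star_closed_of_convex K : compact K ->
  (forall A, A `*` A `<=` K ->
    exists C : set V, [/\ convex_set C, closed C, A `<=` C & C `*` C `<=` K]) ->
  weak_star_closed Omega (admissible Omega K).
Proof.
move=> kK Kconv u_ u uK uoo u_u.
have cK : closed K by apply: compact_closed => //; exact: norm_hausdorff.
have [mu_ _] := uoo.
apply: (@admissible_of_cartesian _ _ _ _ u K (essential_range Omega u)) => //; last first.
  exact: ae_essential_range.
have coord (v : 'rV[R]_n -> V) S i : measurable_fun Omega v -> measurable S ->
    S `<=` Omega -> measurable_fun S (fun x => v x ord0 i).
  move=> mv mS SO; apply: measurableT_comp (measurable_rV_coord i) _.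
  exact: measurable_funS mv.
have limK S T : measurable S -> S `<=` Omega -> (0 < mu S)%E ->
    measurable T -> T `<=` Omega -> (0 < mu T)%E ->
    K (average mu S u, average mu T u).
  move=> mS SO S0 mT TO T0.
  apply: (@closed_cvg _ _ \oo _ (fun j => (average mu S (u_ j), average mu T (u_ j)))
    K cK _ (average mu S u, average mu T u)); last first.
    exact: (cvg_pair (weak_star_cvg_average mS SO u_u) (weak_star_cvg_average mT TO u_u)).
  apply: nearW => j; have [[muj _] _] := uK j.
  have [|C [cC clC uC CK]] := Kconv (essential_range Omega (u_ j)).
    by move=> [a b] [/= ua ub]; exact: (essential_range_pair mO cK (uK j)).
  have kC : compact C.
    apply: (subclosed_compact clC (B := fst @` K)).
      by apply: continuous_compact => //; apply: continuous_subspaceT => p; exact: cvg_fst.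
    by move=> x Cx; exists (x, x) => //; exact: CK.
  have avC W : measurable W -> W `<=` Omega -> (0 < mu W)%E -> C (average mu W (u_ j)).
    move=> mW WO W0; apply: average_convex => //.
    - by apply: le_lt_trans Ofin; apply: le_measure; rewrite ?inE.
    - by move=> i; exact: coord.
    - have := ae_essential_range mO muj; apply: filterS => x h Wx.
      exact/uC/h/WO.
  by apply: CK; split => /=; exact: avC.
(* Near an essential value xi, average over the part of Omega where u is close
   to xi. *)
have near_avg xi W : essential_range Omega u xi -> nbhs xi W ->
    exists S, [/\ measurable S, S `<=` Omega, (0 < mu S)%E & W (average mu S u)].
  move=> exi /nbhs_closedballP[e eW].
  have [c [cxi ce]] := rat_box_base (nbhsx_ballx xi e%:num ltac:(by [])).
  have mp := measurable_piece mO c mu_.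
  have pO : piece Omega u c `<=` Omega by move=> x [].
  exists (piece Omega u c); split => //; first exact: exi.
  apply: eW; apply: average_convex => //.
  - exact: exi.
  - by apply: le_lt_trans Ofin; apply: le_measure; rewrite ?inE.
  - by move=> i; exact: coord.
  - apply: convex_closure; apply/convex_setE => t a b /andP[t0 t1].
    rewrite -ball_normE /ball_/= => ha hb.
    have -> : xi - (t *: a + (1 - t) *: b) = t *: (xi - a) + (1 - t) *: (xi - b).
      by apply/rowP => k; rewrite !mxE; ring.
    rewrite (le_lt_trans (ler_normD _ _))// !normrZ !gtr0_norm ?subr_gt0//.
    have -> : e%:num = t * e%:num + (1 - t) * e%:num by ring.
    by rewrite ltrD// ltr_pM2l// subr_gt0.
  - apply: bounded_closed_compact; last exact: closed_ball_closed.
    rewrite closed_ballE//; exists (`|xi| + e%:num); split; first exact: num_real.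
    move=> M eM y /= ye; rewrite (le_trans _ (ltW eM))//.
    by rewrite -[y](subrKC xi) (le_trans (ler_normD _ _))// lerD2l distrC.
  - by apply: aeW => x [_ /ce ux]; exact: subset_closure.
move=> [xi zeta] [/= exi ezeta]; apply: cK => W [[U U']/= [xU zU'] UW].
have [S [mS SO S0 SU]] := near_avg _ _ exi xU.
have [T [mT TO T0 TU]] := near_avg _ _ ezeta zU'.
by exists (average mu S u, average mu T u); split; [exact: limK|exact: UW].
Qed.

End weak_star.

(** * Oscillating step functions *)

Section oscillation.
Context (R : realType) (n m : nat) (Omega : set 'rV[R]_n).
Local Notation mu := (lebesgue_rV R n).
Local Notation V := ('rV[R]_m).
Hypothesis mO : measurable Omega.
Implicit Types (K : set (V * V)) (A : set V) (G H Q : set 'rV[R]_n).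

(** The step function with value a on G, b on H and d elsewhere, for disjoint
    G and H. *)
Definition step_fun G H (a b d : V) (x : 'rV[R]_n) : V :=
  d + \1_G x *: (a - d) + \1_H x *: (b - d).

Lemma step_fun_cases G H a b d x : [disjoint G & H] ->
  [\/ G x /\ step_fun G H a b d x = a, H x /\ step_fun G H a b d x = b |
      [/\ ~ G x, ~ H x & step_fun G H a b d x = d]].
Proof.
move=> /disj_setPLR GH; rewrite /step_fun !indicE.
have [Gx|nGx] := pselect (G x).
  rewrite (mem_set Gx) memNset; last exact: GH.
  by apply: Or31; split => //; rewrite scale1r scale0r addr0 addrC subrK.
rewrite (memNset nGx) scale0r addr0; have [Hx|nHx] := pselect (H x).
  by apply: Or32; split => //; rewrite (mem_set Hx) scale1r addrC subrK.
by apply: Or33; split => //; rewrite (memNset nHx) scale0r addr0.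
Qed.

Lemma measurable_step_fun G H a b d : measurable G -> measurable H ->
  measurable_fun setT (step_fun G H a b d).
Proof.
move=> mG mH; apply/measurable_fun_rVP => i; rewrite /step_fun.
under eq_fun do rewrite !mxE.
apply: measurable_funD.
  apply: measurable_funD; first exact: measurable_cst.
  by apply: measurable_funM; [exact: measurable_indic|exact: measurable_cst].
by apply: measurable_funM; [exact: measurable_indic|exact: measurable_cst].
Qed.

Lemma step_fun_Linfty G H a b d : [disjoint G & H] ->
  measurable G -> measurable H -> Linfty Omega (step_fun G H a b d).
Proof.
move=> GH mG mH; split; first by apply: measurable_funTS; exact: measurable_step_fun.
exists (`|a| + `|b| + `|d|); apply: aeW => x _.
have a0 := normr_ge0 a; have b0 := normr_ge0 b; have d0 := normr_ge0 d.
by have [[_ ->]|[_ ->]|[_ _ ->]] := step_fun_cases a b d x GH; lra.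
Qed.

Lemma step_fun_admissible G H a b d K A : [disjoint G & H] ->
  measurable G -> measurable H -> A `*` A `<=` K -> A a -> A b -> A d ->
  admissible Omega K (step_fun G H a b d).
Proof.
move=> GH mG mH AK Aa Ab Ad; apply: (admissible_of_cartesian AK).
  exact: step_fun_Linfty.
apply: aeW => x _.
by have [[_ ->]|[_ ->]|[_ _ ->]] := step_fun_cases a b d x GH.
Qed.

Lemma essential_range_of_positive (u : 'rV[R]_n -> V) G xi : measurable_fun Omega u ->
  measurable G -> G `<=` Omega -> (0 < mu G)%E -> (forall x, G x -> u x = xi) ->
  essential_range Omega u xi.
Proof.
move=> mu_ mG GO G0 uG c cxi; apply: (lt_le_trans G0).
apply: le_measure; rewrite ?inE//; first exact: measurable_piece.
by move=> x Gx; split; [exact: GO|rewrite /= uG].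
Qed.

Variables (Q : set 'rV[R]_n) (y : 'rV[R]_n -> R) (c : R).
Hypotheses (mQ : measurable Q) (QO : Q `<=` Omega) (my : measurable_fun Q y).
Hypotheses (c0 : 0 < c) (y01 : forall x, Q x -> 0 <= y x < 1).
Hypothesis muy : forall a b, 0 <= a -> a <= b -> b <= 1 ->
  mu (Q `&` y @^-1` `[a, b[) = ((b - a) * c)%:E.

(** The part of Q where the k-th Rademacher function is 1. *)
Definition osc_set k : set 'rV[R]_n := Q `&` rademacher y k @^-1` [set 1].

Lemma measurable_osc_set k : measurable (osc_set k).
Proof. by apply: (bounded_measurable_rademacher mQ my y01 k).1. Qed.

Lemma osc_disjoint k : [disjoint osc_set k & Q `\` osc_set k].
Proof. by apply/disj_setPLR => x Gx [_]; apply. Qed.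

(** The function that alternates between a and b on Q, following the
    Rademacher functions. *)
Definition osc k (a b d : V) := step_fun (osc_set k) (Q `\` osc_set k) a b d.

(** On Q the oscillating function is (a + b) / 2 plus a Rademacher function times
    (a - b) / 2. *)
Lemma osc_split k a b d x : osc k a b d x =
  step_fun Q set0 (2^-1 *: (a + b)) 0 d x +
    (\1_Q x * rademacher y k x) *: (2^-1 *: (a - b)).
Proof.
have Q0 : [disjoint Q & (set0 : set 'rV[R]_n)] by apply/disj_setPLR => z _ [].
rewrite /osc.
have [[[Qx rx] ->]|[[Qx nGx] ->]|[nGx nHx ->]] :=
  step_fun_cases a b d x (osc_disjoint k).
- have [[_ ->]|[[]]|[/(_ Qx)//]] := step_fun_cases (2^-1 *: (a + b)) 0 d x Q0.
  by rewrite indicE mem_set// rx mul1r; apply/rowP => i; rewrite !mxE; field.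
- have [[_ ->]|[[]]|[/(_ Qx)//]] := step_fun_cases (2^-1 *: (a + b)) 0 d x Q0.
  have -> : rademacher y k x = -1.
    have : rademacher y k x <> 1 by move=> rx; apply: nGx; split.
    rewrite /rademacher -signr_odd; case: odd => //= /(_ (expr0 _)).
  by rewrite indicE mem_set// mul1r; apply/rowP => i; rewrite !mxE; field.
- have nQ : ~ Q x by move=> Qx; apply: nHx; split.
  have [[]//|[[]]|[_ _ ->]] := step_fun_cases (2^-1 *: (a + b)) 0 d x Q0.
  by rewrite indicE memNset// mul0r scale0r addr0.
Qed.

Lemma bounded_measurable_coord (u : 'rV[R]_n -> V) i (M : R) :
  measurable_fun Omega u -> (forall x, `|u x| <= M) ->
  bounded_measurable Omega (fun x => u x ord0 i).
Proof.
move=> mu_ uM; split; first exact: measurableT_comp (measurable_rV_coord i) mu_.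
by exists M => x _; rewrite (le_trans (ler_coord_norm _ _)).
Qed.

Lemma osc_weak_star a b d : weak_star_cvg Omega (fun k => osc k a b d)
  (step_fun Q set0 (2^-1 *: (a + b)) 0 d).
Proof.
move=> phi L1phi; set u := step_fun Q set0 _ _ _.
pose psi x := \sum_i (2^-1 *: (a - b)) ord0 i * phi x ord0 i.
have intpsi : mu.-integrable Omega (EFin \o psi).
  apply: (integrable_Rsum mO (f := fun i x => (2^-1 *: (a - b)) ord0 i * phi x ord0 i)).
  move=> i; apply: integrable_boundedM => //; first exact: bounded_measurable_cst.
  exact: L1phi.
have intu : mu.-integrable Omega (EFin \o (fun x => \sum_i u x ord0 i * phi x ord0 i)).
  apply: (integrable_Rsum mO (f := fun i x => u x ord0 i * phi x ord0 i)) => i.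
  apply: integrable_boundedM => //; last exact: L1phi.
  apply: (@bounded_measurable_coord u i (`|2^-1 *: (a + b)| + `|d|)).
    by apply: measurable_funTS; exact: measurable_step_fun.
  have Q0 : [disjoint Q & (set0 : set 'rV[R]_n)] by apply/disj_setPLR => z _ [].
  move=> x.
  rewrite /u; have [[_ ->]|[[]]|[_ _ ->]] := step_fun_cases (2^-1 *: (a + b)) 0 d x Q0.
    by rewrite lerDl.
  by rewrite lerDr.
have intr k : mu.-integrable Q (EFin \o (fun x => rademacher y k x * psi x)).
  apply: integrable_boundedM => //; last exact: integrableS intpsi.
  exact: bounded_measurable_rademacher.
have E k : dual_pairing Omega (osc k a b d) phi =
    dual_pairing Omega u phi + \int[mu]_(x in Q) (rademacher y k x * psi x).
  rewrite -[X in \int[mu]_(x in X) (rademacher _ _ _ * _)](setIidr QO).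
  rewrite Rintegral_mkcondr /dual_pairing -RintegralD//.
    apply: eq_Rintegral => x _; rewrite patchE.
    transitivity (\sum_i u x ord0 i * phi x ord0 i + \1_Q x * rademacher y k x * psi x).
      rewrite /psi mulr_sumr -big_split/=; apply: eq_bigr => i _.
      by rewrite osc_split mxE [X in _ + X]mxE mulrDl mulrA.
    by congr (_ + _); rewrite indicE; case: ifP; rewrite ?mul1r ?mul0r.
  rewrite -restrict_EFin; apply/integrable_restrict => //; by rewrite setIidr.
under eq_fun do rewrite E.
have intQ : mu.-integrable Q (EFin \o psi) by exact: integrableS intpsi.
have := cvgD (cvg_cst (dual_pairing Omega u phi))
  (rademacher_cvg0 mQ my c0 y01 muy intQ).
by rewrite addr0; apply.
Qed.

End oscillation.

(** * Weak-star closedness makes Cartesian squares enlargeable to convex ones *)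

Section necessity.
Context (R : realType) (n m : nat) (Omega : set 'rV[R]_n.+1).
Local Notation mu := (lebesgue_rV R n.+1).
Local Notation V := ('rV[R]_m).
Hypotheses (oO : open Omega) (O0 : Omega !=set0).
Variable K : set (V * V).
Hypotheses (cK : closed K) (wK : weak_star_closed Omega (admissible Omega K)).

(** Oscillating between a and b on one half of a small cube and taking the value
    d elsewhere, one obtains in the limit a function with the essential values
    (a + b) / 2 and d. *)
Lemma weak_star_closed_midpoint A a b d : A `*` A `<=` K -> A a -> A b -> A d ->
  let z := 2^-1 *: (a + b) in [/\ K (z, z), K (z, d) & K (d, z)].
Proof.
move=> AK Aa Ab Ad z; have mO := open_measurable_rV oO.
have [v Ov] := O0.
have [k [_ kO]] := rat_box_base (open_nbhs_nbhs (conj oO Ov)).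
pose q : 'rV[R]_n.+1 := \row_i ratr (k.1 ord0 i); pose l : R := k.2.+1%:R^-1.
have l0 : 0 < l by rewrite invr_gt0.
pose c := l * (l *+ 2) ^+ n.
have c0 : 0 < c by rewrite mulr_gt0// exprn_gt0// mulrn_wgt0.
pose y (x : 'rV[R]_n.+1) := (x ord0 ord0 - q ord0 ord0) / l.
(* The oscillation takes place on Q; P is disjoint from Q, the cube contains
   both. *)
pose Q := slab q l 0 1; pose P := slab q l (- 2^-1) 0.
have slabO s t : -1 < s -> t <= 1 -> slab q l s t `<=` Omega.
  by move=> s1 t1; apply: subset_trans kO; exact: slab_sub_box.
have QO : Q `<=` Omega by apply: slabO => //; lra.
have PO : P `<=` Omega by apply: slabO => //; lra.
have mQ : measurable Q by exact: measurable_slab.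
have mP : measurable P by exact: measurable_slab.
have Q0 : (0 < mu Q)%E by rewrite lebesgue_slab// lte_fin subr0 mul1r.
have P0 : (0 < mu P)%E.
  by rewrite lebesgue_slab ?oppr_le0 ?invr_ge0// lte_fin mulr_gt0// sub0r opprK
    invr_gt0.
have slab_y s t x : slab q l s t x -> s <= y x < t.
  move=> /(_ ord0); rewrite eqxx /= in_itv/= /y => /andP[lo hi].
  by rewrite ler_pdivlMr// ltr_pdivrMr// lerBrDl ltrBlDl lo.
have y01 x : Q x -> 0 <= y x < 1 by exact: slab_y.
have my : measurable_fun Q y.
  apply: measurable_funTS; apply: measurable_funM; last exact: measurable_cst.
  by apply: measurable_funB; [exact: measurable_rV_coord|exact: measurable_cst].
have muy s t : 0 <= s -> s <= t -> t <= 1 ->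
    mu (Q `&` y @^-1` `[s, t[) = ((t - s) * c)%:E.
  move=> s0 st t1; rewrite -(lebesgue_slab q l0 st); congr (mu _).
  apply/seteqP; split=> [x [Qx]|x sx].
    rewrite /= in_itv/= /y ler_pdivlMr// ltr_pdivrMr// lerBrDl ltrBlDl => yx i.
    by have := Qx i; case: eqP => // -> _; rewrite /= in_itv.
  split; last by rewrite /= in_itv/= slab_y.
  move=> i; have := sx i; case: eqP => // -> /=; rewrite !in_itv/= => /andP[lo hi].
  rewrite (le_trans _ lo) ?lerD2l ?ler_pM2r//.
  by rewrite (lt_le_trans hi)// lerD2l ler_pM2r.
have dQ : [disjoint Q & (set0 : set 'rV[R]_n.+1)] by apply/disj_setPLR => x _ [].
pose u := step_fun Q set0 z 0 d.
have uoo : Linfty Omega u by exact: step_fun_Linfty.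
have uK : admissible Omega K u.
  apply: (wK (u_ := fun k => osc Q y k a b d)) => //.
    move=> j; have mG := measurable_osc_set mQ my y01 j.
    apply: (@step_fun_admissible _ _ _ _ _ _ _ _ _ _ A) => //.
    - exact: osc_disjoint.
    - exact: measurableD.
  exact: (osc_weak_star mO mQ QO my c0 y01 muy).
have ez : essential_range Omega u z.
  apply: (@essential_range_of_positive _ _ _ _ mO u Q) => //; first exact: uoo.1.
  move=> x Qx; rewrite /u.
  by have [[_ ->]|[[]]|[/(_ Qx)]] := step_fun_cases z 0 d x dQ.
have ed : essential_range Omega u d.
  apply: (@essential_range_of_positive _ _ _ _ mO u P) => //; first exact: uoo.1.
  move=> x Px; rewrite /u; have [[Qx _]|[[]]|[_ _ ->]] // := step_fun_cases z 0 d x dQ.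
  have /andP[_ yP] := slab_y _ _ _ Px; have /andP[yQ _] := slab_y _ _ _ Qx.
  by have := le_lt_trans yQ yP; rewrite ltxx.
by split; exact: (essential_range_pair mO cK uK).
Qed.

Lemma weak_star_closed_convex A0 : A0 `*` A0 `<=` K ->
  exists C : set V, [/\ convex_set C, closed C, A0 `<=` C & C `*` C `<=` K].
Proof.
move=> /maximal_cartesian_ext[A [A0A AK maxA]].
have cA : closed A.
  move=> x Ax; have AAK := cartesian_closure cK AK.
  apply: maxA; first exact: AAK.
  by move=> a Aa; split; apply: AAK; split => //; exact: subset_closure.
exists A; split => //; apply: closed_midpoint_convex => // a b Aa Ab.
apply: maxA => [|d Ad].
  by have [] := weak_star_closed_midpoint AK Aa Ab Aa.
by have [] := weak_star_closed_midpoint AK Aa Ab Ad; split.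
Qed.

End necessity.

(** * Separately convex hulls of diagonal symmetrizations *)

Section hull.
Context (R : realType) (m : nat).
Local Notation V := ('rV[R]_m).
Implicit Types (A : set V) (E K : set (V * V)).

Lemma diag_sym_idem E : diag_sym (diag_sym E) = diag_sym E.
Proof. by apply/seteqP; split=> [p []//|[a b] [? ? ? ?]]; split; split. Qed.

Lemma cartesian_diag_sym E A : A `*` A `<=` E -> A `*` A `<=` diag_sym E.
Proof. by move=> AE [a b] [/= Aa Ab]; split; apply: AE. Qed.

Lemma sub_sc_hull E : E `<=` sc_hull E.
Proof. exact: sub_gen_smallest. Qed.

Lemma separately_convex_sc_hull E : separately_convex (sc_hull E).
Proof.
move=> t p q t01 Ep Eq pq F [sF EF].
exact: (sF t p q t01 (Ep _ (conj sF EF)) (Eq _ (conj sF EF)) pq).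
Qed.

Lemma pair_cartesian K a b : diag_sym K (a, b) ->
  [set a; b] `*` [set a; b] `<=` K.
Proof. by move=> [/= ? ? ? ?] [x z] [/= [->|->] [->|->]]. Qed.

Lemma segment_sub_convex A a b : convex_set A -> A a -> A b -> segment a b `<=` A.
Proof.
move=> /convex_setE cA Aa Ab _ [t /= /andP[t0 t1] <-].
move: t0; rewrite le_eqVlt => /predU1P[<-|t0].
  by rewrite scale0r add0r subr0 scale1r.
move: t1; rewrite le_eqVlt => /predU1P[->|t1].
  by rewrite scale1r subrr scale0r addr0.
by apply: cA => //; rewrite t0.
Qed.

Lemma diag_sym_cartesian_convex K A : closed K ->
  diag_sym (sc_hull (diag_sym K)) = diag_sym K -> A `*` A `<=` K ->
  exists C : set V, [/\ convex_set C, closed C, A `<=` C & C `*` C `<=` K].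
Proof.
move=> cK KE /cartesian_diag_sym AK.
have [D [cD AD DF]] := separately_convex_cartesian
  (@separately_convex_sc_hull _) (subset_trans AK (@sub_sc_hull _)).
exists (closure D); split.
- exact: convex_closure.
- exact: closed_closure.
- exact: subset_trans AD (@subset_closure _ _).
- apply: cartesian_closure => // p /(cartesian_diag_sym DF).
  by rewrite KE => -[].
Qed.

(** E contains the square spanned by the two components of each of its points. *)
Definition square_filled E : Prop :=
  forall a b, E (a, b) -> square a b `<=` E.

Lemma square_filled_diag_sym K :
  (forall A, A `*` A `<=` K ->
    exists C : set V, [/\ convex_set C, closed C, A `<=` C & C `*` C `<=` K]) ->
  square_filled (diag_sym K).
Proof.
move=> Kconv a b /pair_cartesian/Kconv[C [cC _ abC CK]].
apply: subset_trans (cartesian_diag_sym CK).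
have abC' : segment a b `<=` C.
  by apply: segment_sub_convex => //; apply: abC; [left|right].
by move=> [x z] [/= /abC' Cx /abC' Cz].
Qed.

End hull.

(** * The one-dimensional case and the characterization *)

(** In one dimension a point of a vertical or horizontal segment with endpoints
    in E lies in the square spanned by one of the endpoints. *)
Lemma square_filled_separately_convex (R : realType)
    (E : set ('rV[R]_1 * 'rV[R]_1)) :
  diag_sym E = E -> square_filled E -> separately_convex E.
Proof.
move=> Esym Efill.
have sym a b : E (a, b) -> E (b, a) by rewrite -{1}Esym => -[].
have segP (a b x : 'rV[R]_1) :
    a ord0 ord0 <= x ord0 ord0 <= b ord0 ord0 -> segment a b x.
  move=> /andP[ax xb]; have [ab|ab] := eqVneq (a ord0 ord0) (b ord0 ord0).
    exists 1; first by rewrite /= ler01 lexx.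
    apply/rowP => i; rewrite (ord1 i) !mxE subrr mul0r addr0 mul1r.
    by apply/eqP; rewrite eq_le ax ab xb.
  have ab0 : 0 < b ord0 ord0 - a ord0 ord0.
    by rewrite subr_gt0 lt_neqAle ab (le_trans ax).
  exists ((b ord0 ord0 - x ord0 ord0) / (b ord0 ord0 - a ord0 ord0)).
    by rewrite /= divr_ge0 ?(ltW ab0) ?subr_ge0//= ler_pdivrMr// mul1r lerD2l lerN2.
  by apply/rowP => i; rewrite (ord1 i) !mxE; field; exact: lt0r_neq0.
have segC (a b : 'rV[R]_1) : segment a b `<=` segment b a.
  move=> _ [t /= /andP[t0 t1] <-]; exists (1 - t).
    by rewrite /= subr_ge0 t1 lerBlDr lerDl.
  by rewrite subKr addrC.
have seg_l (a b : 'rV[R]_1) : segment a b a.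
  by exists 1; rewrite /= ?ler01 ?lexx// scale1r subrr scale0r addr0.
have seg_r (a b : 'rV[R]_1) : segment a b b by exact/segC/seg_l.
(* Convexity along vertical segments, with endpoints ordered or not. *)
have vert (t : R) (x p q : 'rV[R]_1) : 0 < t < 1 -> E (x, p) -> E (x, q) ->
    E (x, t *: p + (1 - t) *: q).
  wlog pq : t p q / p ord0 ord0 <= q ord0 ord0.
    move=> h t01 Ep Eq; have [pq|/ltW qp] := leP (p ord0 ord0) (q ord0 ord0).
      exact: h.
    rewrite (_ : _ + _ = (1 - t) *: q + (1 - (1 - t)) *: p); last first.
      by rewrite subKr addrC.
    by apply: h => //; case/andP: t01 => t0 t1; rewrite subr_gt0 t1 ltrBlDr ltrDl.
  move=> /andP[t0 t1] Ep Eq; set z := _ + _.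
  have [pz zq] : p ord0 ord0 <= z ord0 ord0 /\ z ord0 ord0 <= q ord0 ord0.
    by rewrite /z !mxE; split; nra.
  have [xz|zx] := leP (x ord0 ord0) (z ord0 ord0).
    by apply: (Efill _ _ Eq); split => //=; apply: segP; rewrite xz.
  apply: (Efill _ _ Ep); split => //=; apply/segC/segP.
  by rewrite pz ltW.
move=> t [p1 p2] [q1 q2] t01 Ep Eq /= [pq|pq].
  move: Eq; rewrite -pq => Eq.
  have -> : t *: (p1, p2) + (1 - t) *: (p1, q2) = (p1, t *: p2 + (1 - t) *: q2).
    by congr pair; rewrite /= -scalerDl addrC subrK scale1r.
  exact: vert.
move: Eq; rewrite -pq => Eq.
have -> : t *: (p1, p2) + (1 - t) *: (q1, p2) = (t *: p1 + (1 - t) *: q1, p2).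
  by congr pair; rewrite /= -scalerDl addrC subrK scale1r.
by apply/sym/vert => //; exact/sym.
Qed.

Theorem corollary5p10 (R : realType) (n m : nat) (Omega : set 'rV[R]_n)
    (K : set ('rV[R]_m * 'rV[R]_m)) :
  (0 < n)%N -> (0 < m)%N ->
  Omega !=set0 -> bounded_set Omega -> open Omega ->
  compact K ->
  ((1 < m)%N ->
    [/\ compact (sc_hull (diag_sym K)),
        diag_sym (sc_hull (diag_sym K)) =
          \bigcup_(p in diag_sym K) square p.1 p.2
      & maximal_cartesian (sc_hull (diag_sym K)) `<=`
          [set square p.1 p.2 | p in diag_sym K]]) ->
  (weak_star_closed Omega (admissible Omega K) <->
     diag_sym (sc_hull (diag_sym K)) = diag_sym K) /\
  (m = 1%N ->
     (diag_sym (sc_hull (diag_sym K)) = diag_sym K <->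
      separately_convex (diag_sym K))).
Proof.
case: n Omega => // n Omega _ m0 O0 bO oO kK Kstruct.
have mO := open_measurable_rV oO.
have Ofin := bounded_set_rV_finite mO bO.
have cK : closed K by apply: compact_closed => //; exact: norm_hausdorff.
have hull_sc : separately_convex (diag_sym K) ->
    diag_sym (sc_hull (diag_sym K)) = diag_sym K.
  by move=> sK; rewrite /sc_hull smallest_id// diag_sym_idem.
have sc_m1 : m = 1%N -> square_filled (diag_sym K) -> separately_convex (diag_sym K).
  move: (m) K {kK Kstruct cK hull_sc m0} => m' K' m1; move: m1 K' => -> K'.
  by apply: square_filled_separately_convex; exact: diag_sym_idem.
split; [split=> [wK|KE]|move=> m1; split=> // KE].
- have fill : square_filled (diag_sym K).
    by apply: square_filled_diag_sym => A; exact: (weak_star_closed_convex oO O0 cK wK).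
  have [m1|] := ltnP 1 m.
    have [_ -> _] := Kstruct m1.
    apply/seteqP; split=> [p [[a b] /= Kab]|[a b] Kab]; first exact: (fill _ _ Kab).
    exists (a, b) => //=; split => /=.
      by exists 1; rewrite /= ?ler01 ?lexx// scale1r subrr scale0r addr0.
    by exists 0; rewrite /= ?ler01 ?lexx// scale0r subr0 scale1r add0r.
  move=> m1; apply/hull_sc/sc_m1 => //; apply/eqP; rewrite eqn_leq m1; exact: m0.
- apply: weak_star_closed_of_convex => // A; exact: diag_sym_cartesian_convex.
- apply: sc_m1 => //; apply: square_filled_diag_sym => A.
  exact: diag_sym_cartesian_convex.
Qed.
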